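(* Let $\tilde F_k$ ($k\ge 1$) be the stable cluster variables of the framed Kronecker quiver with mutation sequence $(0,1,0,1,\ldots)$, as defined in the context. Then, as $k\to\infty$, the $\tilde F_k$ converge as formal power series in $y_0,y_1$, and $$\lim_{k\to\infty}\tilde F_k \;=\; 1+y_0+2y_0^2y_1+3y_0^3y_1^2+4y_0^4y_1^3+\cdots \;=\; 1+\sum_{i=1}^{\infty} i\, y_0^{i}\,y_1^{i-1}.$$
   Context: Quiver mutation. A quiver is a finite directed graph, possibly with multiple edges, without self-loops or 2-cycles; each vertex $v$ carries a label $\ell_v$. Mutation at a vertex $v$: (1) replace the label $\ell_v$ by $\bigl(\prod_{\text{arrows } u\to v}\ell_u+\prod_{\text{arrows } v\to u}\ell_u\bigr)/\ell_v$ (products over arrows with multiplicity, using the arrows before mutation); (2) for every 2-path $u\to v\to w$ add an arrow $u\to w$; (3) delete newly created self-loops and cancel newly created 2-cycles in pairs; (4) reverse all arrows incident to $v$. Framed Kronecker quiver $Q_0$: vertices $0,1$ and frozen vertices $0',1'$ (never mutated); arrows: two arrows $1\to 0$, one arrow $0\to 0'$, one arrow $1\to 1'$. Initial labels: $1$ at vertices $0$ and $1$, $y_0$ at $0'$, $y_1$ at $1'$. Mutate successively at $0,1,0,1,\ldots$; $Q_k$ is the quiver after $k$ mutations and $F_k$ is the new label produced at the $k$-th mutation (a polynomial in $y_0,y_1$ with integer coefficients, called the $k$-th F-polynomial). C-matrix: $C_k$ is the $2\times 2$ matrix, rows and columns indexed by $0,1$, whose $(i,j)$ entry is the number of arrows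 $i'\to j$ in $Q_k$ (negative if the arrows point $j\to i'$). Transformation: the $C_k$-matrix transformation sends a monomial $y_0^{a_0}y_1^{a_1}$ to $y_0^{b_0}y_1^{b_1}$ with $\vec b=C_k^{-1}\vec a$, and is extended linearly; $\tilde F_k$ is the image of $F_k$. Convention on parity: for odd $k$ one has $C_k^{-1}=\begin{bmatrix}k&-(k+1)\\k-1&-k\end{bmatrix}$, while for even $k$ the matrix $C_k^{-1}$ is this same expression with its two rows interchanged. To remove the resulting alternation between $y_0$ and $y_1$, the odd form is used for all $k$; that is, for every $k\ge 1$, $\tilde F_k$ is obtained from $F_k$ by replacing each monomial $y_0^{a}y_1^{b}$ by $y_0^{ka-(k+1)b}\,y_1^{(k-1)a-kb}$. Convergence of formal power series means that for each monomial its coefficient in $\tilde F_k$ is eventually constant in $k$, the limit being the series of these eventual coefficients. *)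

(* Defs.v *)
From HB Require Import structures.
From mathcomp Require Import all_boot all_order all_fingroup all_algebra.
From mathcomp Require Import ring zify.
From mathcomp Require Import mpoly.

Set Implicit Arguments.
Unset Strict Implicit.
Unset Printing Implicit Defensive.

Import Order.TTheory GRing.Theory Num.Theory.

Local Open Scope nat_scope.

Section Quivers.

Variable V : finType.

(* [arrows u v] is the multiplicity of the arrow u -> v. *)
Record quiver := Quiver {
  arrows :> V -> V -> nat;
  no_loop : forall u, arrows u u = 0;
  no_2cycle : forall u v, (arrows u v == 0) || (arrows v u == 0)
}.

Definition complete_paths (v : V) (e : V -> V -> nat) : V -> V -> nat :=
  fun u w => e u w + e u v * e v w.

(* Truncated subtraction cancels the 2-cycles in pairs; for u = w it deletes
   the self-loops.  As a quiver has neither, all of those met here are new. *)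
Definition cancel_2cycles (e : V -> V -> nat) : V -> V -> nat :=
  fun u w => e u w - e w u.

Definition reverse_at (v : V) (e : V -> V -> nat) : V -> V -> nat :=
  fun u w => if (u == v) || (w == v) then e w u else e u w.

Definition mutate_arrows (v : V) (q : quiver) : V -> V -> nat :=
  reverse_at v (cancel_2cycles (complete_paths v q)).

Lemma mutate_no_loop v q u : mutate_arrows v q u u = 0.
Proof. by rewrite /mutate_arrows /reverse_at /cancel_2cycles subnn if_same. Qed.

Lemma mutate_no_2cycle v q u w :
  (mutate_arrows v q u w == 0) || (mutate_arrows v q w u == 0).
Proof.
rewrite /mutate_arrows /reverse_at /cancel_2cycles [(w == v) || _]orbC.
by case: ifP => _; rewrite !subn_eq0 leq_total.
Qed.

Definition mutate_quiver (v : V) (q : quiver) : quiver :=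
  Quiver (mutate_no_loop v q) (mutate_no_2cycle v q).

Record labeled_quiver (K : fieldType) := LabeledQuiver {
  lq_quiver :> quiver;
  label : V -> K
}.

Definition mutate_label (K : fieldType) (v : V) (Q : labeled_quiver K) : V -> K :=
  fun w => if w == v
           then ((\prod_(u : V) label Q u ^+ Q u v
                  + \prod_(u : V) label Q u ^+ Q v u) / label Q v)%R
           else label Q w.

Definition mutate (K : fieldType) (v : V) (Q : labeled_quiver K) :
  labeled_quiver K :=
  LabeledQuiver (mutate_quiver v Q) (mutate_label v Q).

End Quivers.

(* [inl i] is the vertex i and [inr i] the frozen vertex i'. *)
Definition vertex : finType := ('I_2 + 'I_2)%type.

Definition framed_Kronecker_arrows (u v : vertex) : nat :=
  match u, v with
  | inl i, inl j => if (i == 1%R) && (j == 0%R) then 2 else 0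
  | inl i, inr j => if i == j then 1 else 0
  | _, _ => 0
  end.

Lemma framed_Kronecker_no_loop u : framed_Kronecker_arrows u u = 0.
Proof. by case: u => -[[|[|]]]. Qed.

Lemma framed_Kronecker_no_2cycle u v :
  (framed_Kronecker_arrows u v == 0) || (framed_Kronecker_arrows v u == 0).
Proof. by case: u => -[[|[|u]] Hu]; case: v => -[[|[|v]] Hv]. Qed.

Definition framed_Kronecker : quiver vertex :=
  Quiver framed_Kronecker_no_loop framed_Kronecker_no_2cycle.

Local Open Scope ring_scope.

(* Integer polynomials and rational functions in y_0 = 'X_0 and y_1 = 'X_1. *)
Definition ypoly : idomainType := {mpoly int[2]}.
Definition yfrac : fieldType := {fraction ypoly}.

Definition yvar (i : 'I_2) : ypoly := ('X_i : {mpoly int[2]}).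

Definition label0 (v : vertex) : yfrac :=
  match v with
  | inl _ => 1
  | inr i => tofrac (yvar i)
  end.

(* The vertex at which the k-th mutation (k >= 1) takes place: 0 for odd k and
   1 for even k. *)
Definition mutation_vertex (k : nat) : 'I_2 := if odd k then 0 else 1.

Fixpoint Q (k : nat) : labeled_quiver vertex yfrac :=
  match k with
  | 0 => LabeledQuiver framed_Kronecker label0
  | k'.+1 => mutate (inl (mutation_vertex k'.+1)) (Q k')
  end.

Definition Flabel (k : nat) : yfrac := label (Q k) (inl (mutation_vertex k)).

Definition Cmx (k : nat) : 'M[int]_2 :=
  \matrix_(i, j) ((Q k (inr i) (inl j))%:Z - (Q k (inl j) (inr i))%:Z).

(* For even k the rows of the inverse C-matrix are interchanged, so that it has
   the form [Cinv_oddE] below for all k >= 1. *)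
Definition Cinv_odd (k : nat) : 'M[int]_2 :=
  if odd k then invmx (Cmx k) else xrow 0 1 (invmx (Cmx k)).

Definition closed_arrows (k : nat) (u v : vertex) : nat :=
  let p := mutation_vertex k.+1 in
  let q := mutation_vertex k in
  match u, v with
  | inl i, inl j => if (i == p) && (j == q) then 2%N else 0%N
  | inl i, inr j =>
      if i == q then (if j == 0 then k.+2 else k.+1) else 0%N
  | inr i, inl j =>
      if j == p then (if i == 0 then k.+1 else k) else 0%N
  | inr _, inr _ => 0%N
  end.

Lemma ord2P (i : 'I_2) : i = 0 \/ i = 1.
Proof. by case: i => [[|[|]]] // H; [left|right]; apply: val_inj. Qed.

Lemma Q_arrowsS k x y (w := inl (mutation_vertex k.+1)) :
  Q k.+1 x y
  = if (x == w) || (y == w)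
    then (Q k y x + Q k y w * Q k w x - (Q k x y + Q k x w * Q k w y))%N
    else (Q k x y + Q k x w * Q k w y - (Q k y x + Q k y w * Q k w x))%N.
Proof. by []. Qed.

Lemma arrowsE k u v : Q k.+1 u v = closed_arrows k u v.
Proof.
elim: k u v => [|k IH] u v; rewrite Q_arrowsS.
  by case: u => u; case: v => v; case: (ord2P u) => ->; case: (ord2P v) => ->.
rewrite !IH /closed_arrows /mutation_vertex /=.
by case: (odd k) => /=; case: u => u; case: v => v;
  case: (ord2P u) => ->; case: (ord2P v) => -> //=; lia.
Qed.

Lemma Cinv_oddE k : (0 < k)%N ->
  Cinv_odd k = \matrix_(i, j)
    (if i == 0 then if j == 0 then k%:Z else - (k.+1)%:Z
     else if j == 0 then (k.-1)%:Z else - k%:Z).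
Proof.
case: k => // k _; set A := \matrix_(i, j) _.
have CA : Cmx k.+1 *m (if odd k.+1 then A else xrow 0 1 A) = 1%:M.
  apply/matrixP => i j.
  rewrite !mxE !big_ord_recl big_ord0 !mxE !arrowsE /closed_arrows.
  rewrite /mutation_vertex /= addr0.
  have t0 : tperm (0 : 'I_2) 1 ord0 = 1 by rewrite tpermL.
  have t1 : tperm (0 : 'I_2) 1 (lift ord0 ord0) = 0.
    by rewrite (_ : lift ord0 ord0 = 1) ?tpermR //; apply: val_inj.
  case: (odd k) => /=; rewrite !mxE ?t0 ?t1 /=;
  case: (ord2P i) => ->; case: (ord2P j) => -> /=; lia.
have [uC _] := mulmx1_unit CA.
have -> : Cinv_odd k.+1 = (if odd k.+1 then invmx (Cmx k.+1)
                       else xrow 0 1 (invmx (Cmx k.+1))) by [].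
have -> : invmx (Cmx k.+1) = if odd k.+1 then A else xrow 0 1 A.
  by apply: (can_inj (mulKmx uC)); rewrite mulmxV // CA.
case: (odd k.+1) => //; apply/matrixP => i j.
by rewrite !mxE tpermK.
Qed.

Fixpoint Fclosed (k : nat) : ypoly :=
  match k with
  | 0 => 1
  | k'.+1 => match k' with
             | 0 => 1 + yvar 0
             | k''.+1 => (1 + yvar 0 + yvar 0 * yvar 1) * Fclosed k'
                         - yvar 0 * yvar 1 * Fclosed k''
             end
  end.

Lemma FclosedS k :
  Fclosed k.+2 = (1 + yvar 0 + yvar 0 * yvar 1) * Fclosed k.+1
                 - yvar 0 * yvar 1 * Fclosed k.
Proof. by []. Qed.

Lemma Fclosed_exchange k :
  Fclosed k.+2 * Fclosed k
  = Fclosed k.+1 ^+ 2 + yvar 0 ^+ k.+2 * yvar 1 ^+ k.+1.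
Proof.
elim: k => [|k IH]; first by rewrite FclosedS /=; ring.
transitivity (Fclosed k.+2 ^+ 2 + yvar 0 * yvar 1
              * (Fclosed k.+2 * Fclosed k - Fclosed k.+1 ^+ 2)).
  have E : (1 + yvar 0 + yvar 0 * yvar 1) * Fclosed k.+1
           = Fclosed k.+2 + yvar 0 * yvar 1 * Fclosed k.
    by rewrite FclosedS subrK.
  rewrite (FclosedS k.+1) mulrBl mulrAC E.
  by move: (Fclosed k.+2) (Fclosed k.+1) (Fclosed k) => a b c; ring.
by rewrite IH !exprS; ring.
Qed.

Lemma Fclosed_neq0 k : Fclosed k != 0.
Proof.
suff H : (Fclosed k).@[fun=> 0] = 1 /\ (Fclosed k.+1).@[fun=> 0] = 1.
  by apply: contraTneq isT => F0; move: H; rewrite F0 meval0 => -[].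
elim: k => [|k [IH1 IH2]]; first by rewrite /= !mevalD meval1 /yvar mevalXU addr0.
split=> //; rewrite FclosedS mevalB !mevalM !mevalD !mevalM meval1 /yvar !mevalXU.
by rewrite IH1 IH2; ring.
Qed.

Lemma prod_vertex (f : vertex -> yfrac) :
  \prod_(u : vertex) f u = f (inl 0) * f (inl 1) * (f (inr 0) * f (inr 1)).
Proof.
rewrite big_sumType /= !big_ord_recl !big_ord0 !mulr1.
by congr (_ * f (inl _) * (_ * f (inr _))); apply: val_inj.
Qed.

Lemma labelE k v :
  label (Q k.+1) v =
    match v with
    | inl i => tofrac (if i == mutation_vertex k.+1 then Fclosed k.+1
                       else Fclosed k)
    | inr i => tofrac (yvar i)
    end.
Proof.
have step n w : label (Q n.+1) w =
    if w == inl (mutation_vertex n.+1)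
    then (\prod_(u : vertex) label (Q n) u ^+ Q n u (inl (mutation_vertex n.+1))
          + \prod_(u : vertex) label (Q n) u ^+ Q n (inl (mutation_vertex n.+1)) u)
         / label (Q n) (inl (mutation_vertex n.+1))
    else label (Q n) w.
  by [].
elim: k v => [|k IH] v; rewrite step.
  case: v => i //; rewrite !prod_vertex /mutation_vertex /=.
  case: (ord2P i) => -> //=.
  by rewrite tofracD tofrac1 !expr0 !expr1 expr1n !mul1r mulr1 divr1.
case: v => i; last by rewrite -[RHS](IH (inr i)).
have inlE (a b : 'I_2) : (inl a == inl b :> vertex) = (a == b) by [].
rewrite inlE; case: eqP => [_|ne]; last first.
  rewrite IH; case: eqP => // ne'; case: ne; move: ne'.
  by rewrite /mutation_vertex /=; case: (odd k) => /=; case: (ord2P i) => ->.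
have F0 : tofrac (Fclosed k) != 0 by rewrite tofrac_eq0 Fclosed_neq0.
apply: (canLR (mulfK _)).
  by rewrite IH; move: F0; rewrite /mutation_vertex /=; case: (odd k).
have -> : label (Q k.+1) (inl (mutation_vertex k.+2)) = tofrac (Fclosed k).
  by rewrite IH /mutation_vertex /=; case: (odd k).
rewrite -tofracM Fclosed_exchange tofracD tofracXn tofracM !tofracXn.
rewrite !prod_vertex !IH !arrowsE /closed_arrows /mutation_vertex.
move: (Fclosed k.+1) (Fclosed k) => f g /=.
by case: (odd k) => /=; rewrite !expr0 ?mul1r ?mulr1.
Qed.

Lemma Flabel_poly k : exists p : {mpoly int[2]}, Flabel k == tofrac p.
Proof.
exists (Fclosed k); case: k => [|k]; first by rewrite tofrac1.
by rewrite /Flabel labelE eqxx.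
Qed.

(* [Flabel k] is a polynomial with integer coefficients, unique as [tofrac] is
   injective. *)
Definition Fpoly (k : nat) : {mpoly int[2]} := xchoose (Flabel_poly k).

Lemma FpolyE k : tofrac (Fpoly k : ypoly) = Flabel k.
Proof. by rewrite (eqP (xchooseP (Flabel_poly k))). Qed.

Definition expv (m : 'X_{1..2}) : 'cV[int]_2 := \col_i (m i)%:Z.

(* The image of F_k under the transformation, as a Laurent polynomial:
   [tildeF k b] is the coefficient of y_0^(b 0 0) y_1^(b 1 0). *)
Definition tildeF (k : nat) (b : 'cV[int]_2) : int :=
  \sum_(m <- msupp (Fpoly k) | Cinv_odd k *m expv m == b) (Fpoly k)@_m.

Definition is_power_series (f : 'cV[int]_2 -> int) : Prop :=
  forall b, f b != 0 -> forall i, 0 <= b i 0.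

(* Formal power series in y_0, y_1 are coefficient functions on 'X_{1..2}. *)
Definition coeffwise_cvg (f : nat -> 'cV[int]_2 -> int) (g : 'X_{1..2} -> int) :
  Prop :=
  forall m : 'X_{1..2}, exists N : nat,
    forall k : nat, (N <= k)%N -> f k (expv m) = g m.

(* 1 + \sum_(i >= 1) i y_0^i y_1^(i-1) *)
Definition limit_series (m : 'X_{1..2}) : int :=
  if m == 0%MM then 1
  else if m 0 == (m 1).+1 then (m 0)%:Z
  else 0.

(* Main.v *)
(* The F-polynomials satisfy a linear recurrence, solved by
   F_k = \sum_(a, b) C(a-1, b) C(k-b, a-b) y_0^a y_1^b.  The odd inverse
   C-matrix is an involution, so the coefficient of y_0^c y_1^d in the image of
   F_k is the one of y_0^a y_1^b in F_k, where a = k(c-d) - d and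
   a - b = c - d.  For large k this forces c - d <= 1, since a <= k in F_k;
   for c = d + 1 one gets a = k - d and the coefficient C(d+1, 1) = c. *)
Require Import Defs.
From mathcomp Require Import all_boot all_order all_algebra.
From mathcomp Require Import ring zify.
From mathcomp Require Import mpoly.

Set Implicit Arguments.
Unset Strict Implicit.
Unset Printing Implicit Defensive.

Import Order.TTheory GRing.Theory Num.Theory.

Local Open Scope ring_scope.

Lemma Fpoly_Fclosed k : Fpoly k = Fclosed k.
Proof.
apply/eqP; rewrite -(tofrac_eq (Fpoly k : ypoly)) FpolyE.
case: k => [|k]; first by rewrite tofrac1.
by rewrite /Flabel labelE eqxx.
Qed.

(** Subtraction of multinomials is truncated, so the monomials free of ['X_i] have to be treated
    apart. *)
Lemma mcoeffXM n (p : {mpoly int[n]}) (i : 'I_n) (m : 'X_{1..n}) :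
  ('X_i * p)@_m = if m i == 0%N then 0 else p@_(m - U_(i)).
Proof.
case: eqP => [m0|/eqP m_neq0].
  rewrite mulrC mcoeffM big1 // => -[k1 k2] /= /eqP km.
  rewrite mcoeffX; case: eqP => [uk|]; rewrite ?mulr0 //.
  by have /mnmP/(_ i) := km; rewrite mnmDE -uk mnm1E eqxx m0 addn1.
have -> : m = ((m - U_(i)) + U_(i))%MM.
  apply/esym/submK; apply/mnm_lepP=> j.
  by rewrite mnm1E; case: eqP => // <-; rewrite lt0n.
by rewrite (mulrC 'X_i) addmK addmC mcoeffMX.
Qed.

(* [a.-1] gives [1] at [a = b = 0] and [0] at [a = 0 < b]. *)
Definition Fcoeff (k a b : nat) : nat := ('C(a.-1, b) * 'C(k - b, a - b))%N.

(** The second binomial becomes ['C(0, a - b)], which vanishes unless [a <= b]; in that case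
    [a.-1 < b] kills the first one. *)
Lemma Fcoeff_eq0 k a b :
  (k <= b)%N -> (0 < b)%N || (0 < a)%N -> Fcoeff k a b = 0%N.
Proof.
rewrite /Fcoeff -subn_eq0 => /eqP -> ab; rewrite bin0n subn_eq0.
by case: leqP => [le_ab|_]; rewrite ?muln0 // bin_small //; lia.
Qed.

Lemma Fcoeff0 a b : Fcoeff 0 a b = (a == 0%N) && (b == 0%N).
Proof. by case: a b => [|a] [|b] //; rewrite Fcoeff_eq0. Qed.

Lemma Fcoeff1 a b : Fcoeff 1 a b = (a <= 1)%N && (b == 0%N).
Proof.
case: b => [|b]; last by rewrite Fcoeff_eq0 // andbF.
by case: a => [|[|a]] //; rewrite /Fcoeff bin0 subn0 bin_small.
Qed.

(** This is the recurrence of [Fclosed] read off at y_0^(a+1) y_1^(b+1), with the negative term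
    moved to the left to stay in [nat]. Away from the boundary it is Pascal's rule in each
    binomial. *)
Lemma Fcoeff_rec k a b :
  (Fcoeff k.+2 a.+1 b.+1 + Fcoeff k a b
   = Fcoeff k.+1 a.+1 b.+1 + Fcoeff k.+1 a b.+1 + Fcoeff k.+1 a b)%N.
Proof.
have [bk|kb] := leqP b k; last by rewrite !Fcoeff_eq0 //; lia.
rewrite /Fcoeff !subSS /=; case: a => [|a].
  by case: b bk => [|b]; rewrite ?bin0n ?bin0.
rewrite /= subSS; have [ab|ba] := ltnP a b.
  by rewrite (bin_small ab) (@bin_small a b.+1 (ltnW ab)) (@bin_small a.+1 b.+1 ab).
by rewrite !(subSn bk, subSn ba) !binS; ring.
Qed.

Lemma mcoeff_Fclosed k (m : 'X_{1..2}) :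
  (Fclosed k : {mpoly int[2]})@_m = (Fcoeff k (m 0) (m 1))%:Z.
Proof.
have mnm_eq0 (n : 'X_{1..2}) : (n == 0%MM) = (n 0%R == 0%N) && (n 1%R == 0%N).
  apply/eqP/andP => [->|[/eqP n0 /eqP n1]]; first by rewrite !mnm0E.
  by apply/mnmP=> i; rewrite mnm0E; case: (ord2P i) => ->.
(* The recurrence has order two, so the induction carries two consecutive indices. *)
suff: forall m : 'X_{1..2},
    (Fclosed k : {mpoly int[2]})@_m = (Fcoeff k (m 0) (m 1))%:Z
    /\ (Fclosed k.+1 : {mpoly int[2]})@_m = (Fcoeff k.+1 (m 0) (m 1))%:Z.
  by move=> /(_ m) [].
elim: k {m} => [|k IH] m.
  split.
    rewrite [Fclosed 0]/= mcoeff1 mnm_eq0.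
    by rewrite Fcoeff0; case: andP.
  rewrite [Fclosed 1]/= mcoeffD mcoeff1 /yvar -[X in _ + X@__]mulr1.
  rewrite mcoeffXM mcoeff1 !mnm_eq0 !mnmBE !mnm1E /= subn0.
  by rewrite Fcoeff1; case: (m 0%R) (m 1%R) => [|[|a]] [|b].
split; first by have [_] := IH m.
pose f : {mpoly int[2]} := Fclosed k.+1; pose g : {mpoly int[2]} := Fclosed k.
have -> : (Fclosed k.+2 : {mpoly int[2]})
    = f + 'X_0 * f + 'X_0 * ('X_1 * f) - 'X_0 * ('X_1 * g).
  by rewrite FclosedS -/f -/g /yvar; ring.
rewrite mcoeffB !mcoeffD !mcoeffXM !mnmBE !mnm1E /= subn0.
have fE n : f@_n = (Fcoeff k.+1 (n 0) (n 1))%:Z by have [_] := IH n.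
have gE n : g@_n = (Fcoeff k (n 0) (n 1))%:Z by have [] := IH n.
rewrite !fE !gE !mnmBE !mnm1E /= !subn0.
case: (m 0%R) (m 1%R) => [|a] [|b] //=; rewrite ?subn1 ?subn0 /=.
(* For pure powers of y_0 only Pascal's rule in the second binomial is left. *)
- by rewrite /Fcoeff !subn0 !bin0 !mul1n (binS k.+1); lia.
- by have := Fcoeff_rec k a b; lia.
Qed.

(** The matrix has trace 0 and determinant -k^2 + (k+1)(k-1) = -1, so Cayley-Hamilton makes it an
    involution. *)
Lemma Cinv_odd_involutive k : (0 < k)%N -> Cinv_odd k *m Cinv_odd k = 1%:M.
Proof.
move=> k_gt0; rewrite Cinv_oddE //; apply/matrixP => i j.
rewrite !mxE !big_ord_recl big_ord0 !mxE /= addr0.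
by case: k k_gt0 => // k _; case: (ord2P i) => ->; case: (ord2P j) => -> /=; lia.
Qed.

Lemma Cinv_odd_expv k m : (0 < k)%N ->
  ((Cinv_odd k *m expv m) 0 0 = k%:Z * (m 0)%:Z - k.+1%:Z * (m 1)%:Z) *
  ((Cinv_odd k *m expv m) 1 0 = k.-1%:Z * (m 0)%:Z - k%:Z * (m 1)%:Z).
Proof.
move=> k_gt0; rewrite Cinv_oddE //.
have lift01 : lift ord0 ord0 = 1 :> 'I_2 by apply: val_inj.
by rewrite !mxE !big_ord_recl !big_ord0 !mxE /= !lift01; split; ring.
Qed.

Lemma expv_inj : injective expv.
Proof.
by move=> m n /matrixP mn; apply/mnmP=> i; have := mn i 0; rewrite !mxE => -[].
Qed.

(** An involution is injective on exponents, so no two monomials of F_k merge and the sum has at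
    most one term. *)
Lemma tildeF_Cinv_odd k m : (0 < k)%N ->
  tildeF k (Cinv_odd k *m expv m) = (Fcoeff k (m 0) (m 1))%:Z.
Proof.
move=> k_gt0; rewrite -mcoeff_Fclosed -Fpoly_Fclosed /tildeF.
have eq_Cinv n : (Cinv_odd k *m expv n == Cinv_odd k *m expv m) = (n == m).
  apply/eqP/eqP => [E|-> //]; apply: expv_inj.
  by rewrite -[LHS]mul1mx -(Cinv_odd_involutive k_gt0) -mulmxA E mulmxA
             Cinv_odd_involutive // mul1mx.
under eq_bigl do rewrite eq_Cinv.
have [m_in|m_notin] := boolP (m \in msupp (Fpoly k)).
  by rewrite -big_filter filter_pred1_uniq ?msupp_uniq // big_seq1.
rewrite big1_seq ?memN_msupp_eq0 //.
by move=> n /andP[/eqP ->]; rewrite (negbTE m_notin).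
Qed.

Lemma tildeF_neq0 k c : (0 < k)%N -> tildeF k c != 0 ->
  exists2 m, c = Cinv_odd k *m expv m & Fcoeff k (m 0) (m 1) != 0%N.
Proof.
move=> k_gt0 c_neq0.
have [/hasP[m _ /eqP Em]|no_m] :=
    boolP (has (fun m => Cinv_odd k *m expv m == c) (msupp (Fpoly k))).
  by exists m => //; move: c_neq0; rewrite -Em tildeF_Cinv_odd.
case/eqP: c_neq0; rewrite /tildeF big1_seq // => m /andP[cm m_in].
by case/hasP: no_m; exists m.
Qed.

Lemma Fcoeff_neq0 k a b : Fcoeff k a b != 0%N ->
  (a <= k)%N /\ ((b < a)%N \/ a = 0%N /\ b = 0%N).
Proof.
rewrite /Fcoeff muln_eq0 negb_or -!lt0n !bin_gt0.
by case: a => [|a] /=; lia.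
Qed.

(** When b < a <= k, the new exponents satisfy k(a-b) - b >= k - b > 0 and k(a-b) - a >= k - a >=
    0. *)
Lemma tildeF_is_power_series k : (0 < k)%N -> is_power_series (tildeF k).
Proof.
move=> k_gt0 c /(tildeF_neq0 k_gt0)[m -> /Fcoeff_neq0[]].
have [E0 E1] := Cinv_odd_expv m k_gt0.
move: (m 0) (m 1) E0 E1 => a b E0 E1 a_le ab i.
by case: (ord2P i) => ->; rewrite ?E0 ?E1; case: k k_gt0 a_le {E0 E1} => // k;
  case: ab => [|[-> ->]]; nia.
Qed.

Lemma tildeF_cvg : coeffwise_cvg tildeF limit_series.
Proof.
(* The bound [m 1 < k] makes the truncated subtractions below exact and excludes a - b >= 2. *)
move=> m; exists (m 1%R).+1 => k m1_lt_k.
have k_gt0 : (0 < k)%N by apply: leq_trans m1_lt_k.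
rewrite /limit_series; case: eqP => [->|m_neq0].
  have -> : expv 0%MM = Cinv_odd k *m expv 0%MM.
    have -> : expv 0%MM = 0 by apply/matrixP => i j; rewrite !mxE mnm0E.
    by rewrite mulmx0.
  by rewrite tildeF_Cinv_odd // !mnm0E /Fcoeff subnn !bin0.
case: eqP => [m0E|m0_neq].
  (* With d = [m 1], the involution sends (d+1, d) to (k(d+1) - (k+1)d, (k-1)(d+1) - kd) = (k-d,
     k-1-d). *)
  pose n := [multinom (if i == 0%R then k - m 1%R else k.-1 - m 1%R)%N | i < 2].
  have -> : expv m = Cinv_odd k *m expv n.
    have [E0 E1] := Cinv_odd_expv n k_gt0.
    apply/matrixP => i j; rewrite ord1 mxE.
    by case: (ord2P i) => ->; rewrite ?E0 ?E1 ?m0E !mnmE /=; nia.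
  rewrite tildeF_Cinv_odd // !mnmE /= /Fcoeff.
  have -> : ((k - m 1%R).-1 = k.-1 - m 1%R)%N by lia.
  have -> : (k - m 1%R - (k.-1 - m 1%R) = 1)%N by lia.
  rewrite binn bin1; lia.
apply/eqP; apply: contraT => /(tildeF_neq0 k_gt0)[n mn /Fcoeff_neq0[]].
have [] := Cinv_odd_expv n k_gt0; rewrite -mn !mxE => E0 E1 a_le ab.
case: ab => [b_lt|[a0 b0]].
  (* If a - b >= 2, then [m 1] = k(a-b) - a >= 2k - a >= k, which is excluded. So [m 0 - m 1] = a -
     b = 1, against [m0_neq]. *)
  by case: m0_neq; case: k k_gt0 m1_lt_k E0 E1 a_le {mn} => // k; nia.
case: m_neq0; apply/mnmP => i; rewrite mnm0E.
by case: (ord2P i) => ->; move: E0 E1; rewrite a0 b0; lia.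
Qed.

Theorem theorem3p9 :
  (forall k : nat, (0 < k)%N -> is_power_series (tildeF k))
  /\ coeffwise_cvg tildeF limit_series.
Proof. by split; [exact: tildeF_is_power_series | exact: tildeF_cvg]. Qed.
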